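(* For positive integers $s,t,n$ with $t\le s$, we have $$r_2(P^t_s,P^t_n)\le r_2(K_s,P^t_n) < t^{4s}\, n(\log n)^{s-2}.$$
   Context: An ordered graph is a graph on vertex set $\{1,\dots,m\}$ with its natural order; a copy of an ordered graph $H$ in an ordered graph $G$ is an order-preserving embedding sending edges to edges. For ordered graphs $G,H$, $r_2(G,H)$ is the minimum $N$ such that every red/blue coloring of the pairs of $[N]=\{1,\dots,N\}$ contains a red copy of $G$ or a blue copy of $H$. $K_s$ is the complete graph on $s$ vertices. For positive integers $t,n$, the $t$-th power of the path $P_n^t$ is the ordered graph on $\{1,\dots,n\}$ in which $\{i,j\}$ is an edge iff $0<|i-j|\le t$. Logarithms are base $2$.
   Formalization: The strict upper bound is claimed except where it is false or undefined: n=1 with s≠2, and t=1 with s=2, or n=2 and s≥2, or s=n=3 (e.g. t=1, s=2 would read n<n); the first inequality is kept for all s,t,n. *)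

(* Defs.v *)
From mathcomp Require Import all_boot all_order all_algebra.
From mathcomp Require Import reals exp.
Set Implicit Arguments.
Unset Strict Implicit.
Unset Printing Implicit Defensive.

Import Order.TTheory GRing.Theory Num.Theory.

(* Vertices are 0, ..., m - 1 instead of 1, ..., m. *)
Record ograph := OGraph {
  nvert : nat;
  adj : rel 'I_nvert;
  adj_sym : symmetric adj;
  adj_irr : irreflexive adj
}.

Definition is_copy (H G : ograph) (f : {ffun 'I_(nvert H) -> 'I_(nvert G)}) : bool :=
  [forall i : 'I_(nvert H), forall j : 'I_(nvert H), (i < j) ==> (f i < f j)] &&
  [forall i : 'I_(nvert H), forall j : 'I_(nvert H), adj i j ==> adj (f i) (f j)].

Definition contains (G H : ograph) : bool :=
  [exists f : {ffun 'I_(nvert H) -> 'I_(nvert G)}, is_copy f].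

(* Only the values of a coloring on the two-element sets matter;
   true is red and false is blue. *)
Definition coloring (N : nat) := {ffun {set 'I_N} -> bool}.

Definition class_adj (N : nat) (c : coloring N) (b : bool) : rel 'I_N :=
  fun i j => (i != j) && (c [set i; j] == b).

Lemma class_adj_sym (N : nat) (c : coloring N) (b : bool) : symmetric (class_adj c b).
Proof. by move=> i j; rewrite /class_adj eq_sym setUC. Qed.

Lemma class_adj_irr (N : nat) (c : coloring N) (b : bool) : irreflexive (class_adj c b).
Proof. by move=> i; rewrite /class_adj eqxx. Qed.

Definition color_class (N : nat) (c : coloring N) (b : bool) : ograph :=
  OGraph (class_adj_sym c b) (class_adj_irr c b).

Definition arrows (G H : ograph) (N : nat) : bool :=
  [forall c : coloring N,
     contains (color_class c true) G || contains (color_class c false) H].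

Lemma ramsey_seq (a b : nat) : exists N, forall (T : eqType) (c : rel T) (s : seq T),
  N <= size s -> exists u, subseq u s /\
    ((size u == a) && pairwise c u
     \/ (size u == b) && pairwise (fun x y => ~~ c x y) u).
Proof.
elim: a b => [|a IHa] b.
  by exists 0 => T c s _; exists [::]; split; [exact: sub0seq | left].
elim: b => [|b [N2 HN2]].
  by exists 0 => T c s _; exists [::]; split; [exact: sub0seq | right].
have [N1 HN1] := IHa b.+1.
exists (N1 + N2).+1 => T c [|x s] //=; rewrite ltnS => sz.
have step p u : subseq u (filter p s) -> subseq (x :: u) (x :: s) /\ all p u.
  by rewrite subseq_filter /= eqxx => /andP[-> ->].
have [le1|lt1] := leqP N1 (size (filter (c x) s)).
  have [u [su [/andP[/eqP sz1 pw]|ub]]] := HN1 _ c _ le1.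
    have [s1 al] := step _ _ su.
    by exists (x :: u); split=> //; left; rewrite /= sz1 eqxx al pw.
  exists u; split; last by right.
  by apply: subseq_trans su (subseq_trans (filter_subseq _ _) (subseq_cons _ _)).
have le2 : N2 <= size (filter (fun y => ~~ c x y) s).
  move: sz lt1; rewrite !size_filter -(count_predC (c x) s) => sz lt1.
  rewrite -(leq_add2l N1); apply: leq_trans sz _.
  by rewrite leq_add2r ltnW.
have [u [su [ua|/andP[/eqP sz1 pw]]]] := HN2 _ c _ le2.
  exists u; split; last by left.
  by apply: subseq_trans su (subseq_trans (filter_subseq _ _) (subseq_cons _ _)).
have [s1 al] := step _ _ su.
by exists (x :: u); split=> //; right; rewrite /= sz1 eqxx al pw.
Qed.

Lemma contains_class (N : nat) (c : coloring N) (b : bool) (G : ograph)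
    (u : seq 'I_N) :
  subseq u (enum 'I_N) -> size u == nvert G ->
  pairwise (fun x y => c [set x; y] == b) u -> contains (color_class c b) G.
Proof.
move=> su szu pw.
have incr : pairwise (fun x y : 'I_N => x < y) u.
  apply: subseq_pairwise su _.
  rewrite -(pairwise_map val ltn) val_enum_ord -sorted_pairwise; last exact: ltn_trans.
  exact: iota_ltn_sorted.
pose tu : (nvert G).-tuple 'I_N := Tuple szu.
have nthP (r : rel 'I_N) : pairwise r u ->
    forall i j : 'I_(nvert G), i < j -> r (tnth tu i) (tnth tu j).
  move=> pr i j ij; pose x0 := tnth tu i.
  have /(pairwiseP x0) h := pr.
  by rewrite !(tnth_nth x0); apply: h; rewrite ?inE ?(eqP szu).
apply/existsP; exists [ffun i => tnth tu i]; apply/andP; split.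
  apply/'forall_'forall_implyP=> i j ij; rewrite !ffunE; exact: nthP incr _ _ ij.
apply/'forall_'forall_implyP=> i j; rewrite !ffunE /= => aij.
wlog ij : i j aij / i < j.
  move=> h; case: (ltngtP i j) => [|ji|/val_inj eij]; first exact: h.
    by rewrite class_adj_sym; apply: h ji; rewrite adj_sym.
  by rewrite eij adj_irr in aij.
rewrite /class_adj (nthP _ pw _ _ ij) andbT.
by rewrite neq_ltn (nthP _ incr _ _ ij).
Qed.

Lemma arrows_ex (G H : ograph) : exists N, arrows G H N.
Proof.
have [N HN] := ramsey_seq (nvert G) (nvert H).
exists N; apply/forallP=> c; apply/orP.
have sz : N <= size (enum 'I_N) by rewrite size_enum_ord.
have [u [su [/andP[szu pw]|/andP[szu pw]]]] :=
  HN _ (fun x y => c [set x; y]) _ sz; [left | right];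
  apply: contains_class su szu _; apply: sub_pairwise pw => x y.
  by move=> ->.
by move/negbTE=> ->.
Qed.

Definition r2 (G H : ograph) : nat := ex_minn (arrows_ex G H).

Lemma complete_sym (s : nat) : symmetric (fun i j : 'I_s => i != j).
Proof. by move=> i j; rewrite eq_sym. Qed.

Lemma complete_irr (s : nat) : irreflexive (fun i j : 'I_s => i != j).
Proof. by move=> i; rewrite eqxx. Qed.

Definition complete (s : nat) : ograph := OGraph (@complete_sym s) (@complete_irr s).

Definition path_power_adj (t n : nat) : rel 'I_n := fun i j => 0 < `|i - j|%N <= t.

Lemma path_power_sym (t n : nat) : symmetric (@path_power_adj t n).
Proof. by move=> i j; rewrite /path_power_adj distnC. Qed.

Lemma path_power_irr (t n : nat) : irreflexive (@path_power_adj t n).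
Proof. by move=> i; rewrite /path_power_adj distnn. Qed.

Definition path_power (t n : nat) : ograph := OGraph (@path_power_sym t n) (@path_power_irr t n).

Definition log2 (R : realType) (x : R) : R := (ln x / ln 2)%R.

(* The triples (s, t, n) with 0 < t <= s and 0 < n at which the strict bound
   r2 (complete s) (path_power t n) < t^(4s) n (log n)^(s-2) is false or has an
   undefined right-hand side.  For n = 1 the left-hand side is 1 and log n = 0,
   so the right-hand side is 0 if s > 2 and undefined if s = 1.  For t = 1 the
   left-hand side is (s-1)(n-1)+1 and t^(4s) = 1: it is n against n if s = 2,
   s against 2 if n = 2, and 5 against 3 log 3 < 5 if s = n = 3. *)
Definition exceptional (s t n : nat) : bool :=
  (n == 1) && (s != 2)
  || (t == 1) && [|| s == 2, (n == 2) && (2 <= s) | (s == 3) && (n == 3)].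

(* Main.v *)
(** Write f_s(n) for the Ramsey number of K_s versus the t-th power of the path
    on n vertices.  A blue P_a^t found in an initial segment can be prolonged by
    a blue P_b^t lying outside the red neighbourhoods of its last t vertices,
    and each red neighbourhood has fewer than f_{s-1}(a+b) vertices, hence
    f_s(a+b) <= f_s(a) + f_s(b) + t (f_{s-1}(a+b) - 1).  Halving gives
    f_s(2^k) <= 2^k (t (k+1))^(s-2), which is enough for t >= 2.  For t = 1 this
    is too weak, and the exact value (s-1)(n-1)+1 is obtained by labelling each
    vertex with the length of the longest blue path starting from it. *)
Require Import Defs.
From mathcomp Require Import all_boot all_order all_algebra.
From mathcomp Require Import reals exp.
From mathcomp Require Import zify ring lra.

Import Order.TTheory GRing.Theory Num.Theory.
Local Open Scope ring_scope.

(** * Ramsey bounds for a relation on a finite sequence *)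

Section SequenceRamsey.
Local Open Scope nat_scope.

(** With [c] read as red, this is a blue [t]-th power of a path along [u]. Both indices are in
    range, so the default [x0] never matters. *)
Definition avoids_upto {T : Type} (t : nat) (c : rel T) (u : seq T) :=
  forall x0 i j, i < j < size u -> j - i <= t -> ~~ c (nth x0 u i) (nth x0 u j).

Definition clique_or_power {T : eqType} (t s n : nat) (c : rel T) (l : seq T) :=
  exists2 u, subseq u l &
    (size u = s /\ pairwise c u) \/ (size u = n /\ avoids_upto t c u).

(** Arbitrary sequences replace the interval, so that tails and red neighbourhoods can be treated
    without relabelling. *)
Definition ramsey_bound (t s n N : nat) :=
  forall (T : eqType) (c : rel T) (l : seq T),
    N <= size l -> clique_or_power t s n c l.

Lemma clique_or_power_subseq {T : eqType} {t s n : nat} {c : rel T} {l' l : seq T} :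
  subseq l' l -> clique_or_power t s n c l' -> clique_or_power t s n c l.
Proof. by move=> ll' [u /subseq_trans/(_ ll') ul h]; exists u. Qed.

Lemma ramsey_bound_leq {t s n N N' : nat} :
  N <= N' -> ramsey_bound t s n N -> ramsey_bound t s n N'.
Proof. by move=> le h T c l /(leq_trans le) /h. Qed.

Lemma avoids_upto_take {T : Type} (t m : nat) (c : rel T) (u : seq T) :
  avoids_upto t c u -> avoids_upto t c (take m u).
Proof.
move=> h x0 i j /andP[ij]; rewrite size_take_min leq_min => /andP[jm ju] jt.
rewrite !nth_take ?(ltn_trans ij) //; apply: h => //; exact/andP.
Qed.

Lemma ramsey_bound_power_leq {t s n n' N : nat} :
  n <= n' -> ramsey_bound t s n' N -> ramsey_bound t s n N.
Proof.
move=> le h T c l /(h T c l)[u ul [cl|[su av]]]; first by exists u => //; left.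
exists (take n u); first exact: subseq_trans (take_subseq _ _) ul.
by right; rewrite size_takel ?su //; split=> //; apply: avoids_upto_take.
Qed.

Lemma ramsey_bound_clique1 (t n : nat) : ramsey_bound t 1 n 1.
Proof.
move=> T c [|x l] // _; exists [:: x]; last by left.
by rewrite sub1seq mem_head.
Qed.

Lemma ramsey_bound_power1 (t s : nat) : ramsey_bound t s 1 1.
Proof.
move=> T c [|x l] // _; exists [:: x]; first by rewrite sub1seq mem_head.
by right; split=> // x0 i [|j] //=; rewrite andbF.
Qed.

(** Union bound, meant for the red neighbourhoods of the last [t] vertices of a blue power. *)
Lemma count_has_leq {S T : Type} {r : S -> T -> bool} {w : seq S} {l : seq T} {C : nat} :
  all (fun x => count (r x) l <= C) w ->
  count (fun y => has (r^~ y) w) l <= size w * C.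
Proof.
elim: w => [|x w IH] /=; first by rewrite count_pred0.
move=> /andP[hx /IH hw].
rewrite -[X in X <= _](@eq_count _ (predU (r x) (fun y => has (r^~ y) w))) //.
by apply: leq_trans (leq_add hx hw); rewrite -count_predUI leq_addr.
Qed.

(** An edge of the power that crosses the junction has its left end among the last [t] entries of
    [u]. *)
Lemma avoids_upto_cat {T : Type} (t : nat) (c : rel T) (u v : seq T) :
  avoids_upto t c u -> avoids_upto t c v ->
  all (fun y => ~~ has (c^~ y) (drop (size u - t) u)) v ->
  avoids_upto t c (u ++ v).
Proof.
move=> hu hv huv x0 i j /andP[ij]; rewrite size_cat => jlt jt.
rewrite !nth_cat; case: (ltnP j (size u)) => ju.
  by rewrite (ltn_trans ij ju); apply: hu; rewrite ?ij.
case: (ltnP i (size u)) => iu; last by apply: hv; lia.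
have jv : j - size u < size v by lia.
move/(all_nthP x0)/(_ _ jv): huv; rewrite -all_predC => /(all_nthP x0) huv.
have := huv (i - (size u - t)); rewrite size_drop nth_drop /=.
by rewrite subnKC; [apply | ]; lia.
Qed.

(** If one of the last [t] vertices has more than [C] red neighbours in the tail, these contain the
    long blue power or a red clique that the vertex extends. Otherwise deleting at most [t * C] tail
    vertices leaves [B] of them. *)
Lemma ramsey_bound_add {t s a b A B C : nat} :
  ramsey_bound t s.+1 a A -> ramsey_bound t s.+1 b B ->
  ramsey_bound t s (a + b) C.+1 ->
  ramsey_bound t s.+1 (a + b) (A + B + t * C).
Proof.
move=> hA hB hC T c l szl.
have sA : A <= size (take A l) by rewrite size_takel //; lia.
have sD : B + t * C <= size (drop A l) by rewrite size_drop; lia.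
have sl1 := take_subseq l A; have sl2 := drop_subseq l A.
have [u ul1 [cl|[su avu]]] := hA _ c _ sA.
  by apply: clique_or_power_subseq sl1 _; exists u; last left.
pose w := drop (size u - t) u.
have [hw|] := boolP (all (fun x => count (c x) (drop A l) <= C) w); last first.
  case/allPn=> x xw; rewrite -ltnNge => ltC.
  have [|v vl hv] := hC T c [seq y <- drop A l | c x y]; first by rewrite size_filter.
  have vl2 := subseq_trans vl (filter_subseq _ _).
  case: hv => [[sv cv]|hv]; last by exists v; [exact: subseq_trans vl2 sl2 | right].
  exists (x :: v); last first.
    left; rewrite /= sv cv andbT; split=> //.
    by move: vl; rewrite subseq_filter => /andP[].
  rewrite -(cat_take_drop A l) -cat1s; apply: cat_subseq vl2.
  by rewrite sub1seq (mem_subseq ul1) // (mem_drop xw).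
have szw : size w <= t by rewrite size_drop; lia.
have cnt := count_has_leq hw.
have sF : B <= size [seq y <- drop A l | ~~ has (c^~ y) w].
  rewrite size_filter; move: sD.
  rewrite -(count_predC (fun y => has (c^~ y) w) (drop A l)).
  have := leq_mul szw (leqnn C); rewrite [count (predC _) _]/=; lia.
have [v vl hv] := hB _ c _ sF.
have vl2 := subseq_trans vl (filter_subseq _ _).
case: hv => [hv|[sv avv]]; first by exists v; [exact: subseq_trans vl2 sl2 | left].
exists (u ++ v); first by rewrite -(cat_take_drop A l) cat_subseq.
right; rewrite size_cat su sv; split=> //; apply: avoids_upto_cat => //.
by move: vl; rewrite subseq_filter => /andP[].
Qed.

(** Outer induction on [s], inner halving on [k]. For two-vertex cliques the loss term is zero and
    the sizes simply add. *)
Lemma ramsey_bound_pow2 (t s k : nat) : 0 < t ->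
  ramsey_bound t s.+2 (2 ^ k) (2 ^ k * (t * k.+1) ^ s).
Proof.
move=> t0; elim: s k => [|s IHs]; elim=> [|k IHk].
- exact: ramsey_bound_power1.
- have := ramsey_bound_add IHk IHk (ramsey_bound_clique1 t _).
  by rewrite addnn -mul2n -expnS muln0 addn0 expn0 !muln1 addnn -mul2n -expnS.
- apply: ramsey_bound_leq (ramsey_bound_power1 _ _).
  by rewrite mul1n muln1 expn_gt0 t0.
have pos : 0 < 2 ^ k.+1 * (t * k.+2) ^ s by rewrite muln_gt0 !expn_gt0 muln_gt0 t0.
have := IHs k.+1; rewrite -[X in ramsey_bound _ _ _ X](prednK pos) => hs.
have := ramsey_bound_add (a := 2 ^ k) (b := 2 ^ k) IHk IHk.
rewrite addnn -mul2n -expnS => /(_ _ hs); apply: ramsey_bound_leq.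
have le1 : (t * k.+1) ^ s <= (t * k.+2) ^ s by case: (s) => // s'; rewrite leq_exp2r // leq_mul.
rewrite addnn -mul2n.
(* Both terms share the factor [2 ^ k.+1 * (t * k.+2) ^ s], and [t * k.+1 + t = t * k.+2]. *)
apply: (@leq_trans (2 * (2 ^ k * (t * k.+1 * (t * k.+2) ^ s))
                    + t * (2 ^ k.+1 * (t * k.+2) ^ s))).
  by rewrite leq_add ?leq_mul ?leq_pred // expnS leq_mul.
by rewrite !expnS; lia.
Qed.

(* [p.2] is the number of edges of the longest blue path starting at [p.1]. *)
Lemma blue_path_labelling {T : eqType} (c : rel T) (l : seq T) :
  exists z : seq (T * nat),
    [/\ map fst z = l,
        pairwise (fun p q => ~~ c p.1 q.1 ==> (q.2 < p.2)) z
      & forall p, p \in z -> exists u,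
          [/\ size u = p.2, subseq (p.1 :: u) l
            & path (fun x y => ~~ c x y) p.1 u]].
Proof.
elim: l => [|x l [z [zl pz hz]]]; first by exists [::].
(* A longest blue path from [x] steps to a later blue neighbour [q] and follows its longest path;
   with no such neighbour the empty maximum gives 0. *)
pose k := \max_(q <- z | ~~ c x q.1) q.2.+1.
exists ((x, k) :: z); split=> /=; first by rewrite zl.
  rewrite pz andbT; apply/allP=> q qz; apply/implyP=> cq.
  exact: (leq_bigmax_seq (F := fun q => q.2.+1)).
move=> p; rewrite inE => /predU1P[->|/hz[u [su ul pu]]]; last first.
  by exists u; split=> //; apply: subseq_trans ul (subseq_cons _ _).
have [|[q [qz cq kq]]] : k = 0 \/ exists q, [/\ q \in z, ~~ c x q.1 & k = q.2.+1].
  rewrite /k big_seq_cond; elim/big_ind: _ => [|a b ha hb|q /andP[qz cq]]; first by left.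
    by rewrite /maxn; case: ifP.
  by right; exists q.
  by move=> /= ->; exists [::]; rewrite /= eqxx sub0seq.
have [u [su ul pu]] := hz q qz; exists (q.1 :: u).
by rewrite /= eqxx su kq cq pu ul.
Qed.

Lemma avoids_upto1 {T : Type} (c : rel T) (x : T) (u : seq T) :
  path (fun x y => ~~ c x y) x u -> avoids_upto 1 c (x :: u).
Proof.
move=> /pathP pu x0 i j /= /andP[ij ju] ji; have -> : j = i.+1 by lia.
by have := pu x0 i; rewrite /= => -> //; lia.
Qed.

Lemma pigeonhole_count {T : Type} {f : T -> nat} {z : seq T} {n s : nat} :
  all (fun p => f p < n) z -> s * n < size z ->
  exists k, s < count (fun p => f p == k) z.
Proof.
move=> hz lt; have szE : \sum_(k < n) count (fun p => f p == k) z = size z.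
  elim: z hz {lt} => [|p z IH] /= => [_|/andP[pn /IH <-]]; first by rewrite big1.
  rewrite big_split /= (bigD1 (Ordinal pn)) //= eqxx big1 // => i.
  by rewrite -val_eqE eq_sym => /negbTE /= ->.
have [/forallP h|] := boolP [forall k : 'I_n, count (fun p => f p == k) z <= s].
  move: lt; rewrite -szE ltnNge mulnC -[n in n * s]card_ord -sum_nat_const.
  by rewrite leq_sum // => k _; apply: h.
by case/forallPn=> k; rewrite -ltnNge => h; exists (val k).
Qed.

(** A label at least [n] yields the blue path. Otherwise more than [s] vertices share a label, and
    they are pairwise red because labels drop along blue edges. *)
Lemma ramsey_bound_path (s n : nat) : ramsey_bound 1 s.+1 n.+1 (s * n).+1.
Proof.
move=> T c l szl; have [z [zl pz hz]] := blue_path_labelling c l.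
have [al|/allPn[p pz']] := boolP (all (fun p => p.2 < n) z); last first.
  rewrite -leqNgt => np; have [u [su ul pu]] := hz p pz'.
  exists (take n.+1 (p.1 :: u)); first exact: subseq_trans (take_subseq _ _) ul.
  right; rewrite size_takel /= ?su ?ltnS //; split=> //.
  exact: (@avoids_upto_take _ 1 n.+1 c (p.1 :: u) (avoids_upto1 _ _ _ pu)).
have [|k hk] := pigeonhole_count al (s := s).
  by rewrite -(size_map fst) zl.
pose v := take s.+1 [seq p <- z | p.2 == k].
have vz : subseq v z := subseq_trans (take_subseq _ _) (filter_subseq _ _).
exists (map fst v); first by rewrite -zl map_subseq.
left; rewrite size_map size_takel ?size_filter //; split=> //.
rewrite pairwise_map.
have vk : all (fun p => p.2 == k) v.
  by apply/allP=> p /mem_take; rewrite mem_filter => /andP[].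
have := subseq_pairwise vz pz; apply: (sub_in_pairwise (P := fun p => p.2 == k)) => //.
by move=> p q /eqP pk /eqP qk /=; rewrite pk qk ltnn implybF negbK.
Qed.

End SequenceRamsey.

(** * From sequences to ordered graphs *)

Section RamseyNumber.
Local Open Scope nat_scope.

Lemma r2_leq (G H : ograph) (N : nat) : arrows G H N -> r2 G H <= N.
Proof. by rewrite /r2; case: ex_minnP => m _; apply. Qed.

Lemma r2_arrows (G H : ograph) : arrows G H (r2 G H).
Proof. by rewrite /r2; case: ex_minnP. Qed.

(** A subsequence of the enumeration is increasing, so indexing into it preserves order. *)
Lemma contains_seq {N : nat} {c : coloring N} {b : bool} {G : ograph} {u : seq 'I_N} :
  subseq u (enum 'I_N) -> size u = nvert G ->
  (forall x0 (i j : 'I_(nvert G)), i < j -> adj i j ->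
     c [set nth x0 u i; nth x0 u j] = b) ->
  contains (color_class c b) G.
Proof.
move=> su szu h.
have incr : sorted ltn (map val u).
  apply: (subseq_sorted ltn_trans (map_subseq val su)).
  by rewrite val_enum_ord iota_ltn_sorted.
have mono (i j : 'I_(nvert G)) x0 : i < j -> nth x0 u i < nth x0 u j.
  move=> ij; rewrite -!(nth_map x0 0 val) ?szu //.
  by apply: (sorted_ltn_nth ltn_trans) => //; rewrite inE size_map szu.
have tu : size u == nvert G by rewrite szu.
have nthE x0 i : tnth (Tuple tu) i = nth x0 u i by rewrite (tnth_nth x0).
apply/existsP; exists [ffun i => tnth (Tuple tu) i]; apply/andP; split.
  apply/'forall_'forall_implyP=> i j ij; rewrite !ffunE.
  by have x0 := tnth (Tuple tu) i; rewrite !(nthE x0) mono.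
apply/'forall_'forall_implyP=> i j; rewrite !ffunE.
wlog ij : i j / i < j.
  move=> wl; case: (ltngtP i j) => [|ji aij|/val_inj ->]; first exact: wl.
    by rewrite adj_sym wl // adj_sym.
  by rewrite adj_irr.
move=> aij; have x0 := tnth (Tuple tu) i; rewrite !(nthE x0) /= /class_adj h // eqxx andbT.
by rewrite neq_ltn mono.
Qed.

Lemma r2_leq_ramsey_bound {t s n N : nat} :
  ramsey_bound t s n N -> r2 (complete s) (path_power t n) <= N.
Proof.
move=> hN; apply: r2_leq; apply/forallP=> c; apply/orP.
have [|u ul [[su pu]|[su av]]] := hN _ (fun x y => c [set x; y]) (enum 'I_N).
- by rewrite size_enum_ord.
- by left; apply: (contains_seq (G := complete s) ul su) => x0 i j ij _; apply/(pairwiseP x0 pu);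
    rewrite ?inE ?su.
right; apply: (contains_seq (G := path_power t n) ul su) => x0 i j ij /andP[_ tij].
apply/negbTE/av; first by rewrite ij su /=.
by move: tij; rewrite distnEr // ltnW.
Qed.

Lemma contains_path_power (G : ograph) (t s : nat) :
  contains G (complete s) -> contains G (path_power t s).
Proof.
case/existsP=> f /andP[mono /'forall_'forall_implyP ad].
apply/existsP; exists f; apply/andP; split=> //.
apply/'forall_'forall_implyP=> i j /andP[dij _]; apply: ad => /=.
by apply: contraTneq dij => ->; rewrite distnn.
Qed.

Lemma r2_path_power_complete (t s : nat) (H : ograph) :
  r2 (path_power t s) H <= r2 (complete s) H.
Proof.
apply: r2_leq; apply/forallP=> c; have /forallP/(_ c)/orP := r2_arrows (complete s) H.
by case=> [/contains_path_power ->|->]; rewrite ?orbT.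
Qed.

End RamseyNumber.

(** * Comparison with the logarithmic bound *)

Lemma ln2_gt0 (R : realType) : 0 < ln (2 : R).
Proof. by rewrite ln_gt0 // ltr1n. Qed.

(** Turns an integer comparison into the rational lower bound [j / m] for the logarithm. *)
Lemma log2_ge (R : realType) (j m n : nat) : (0 < n)%N -> (2 ^ j <= n ^ m)%N ->
  j%:R <= m%:R * log2 (n%:R : R).
Proof.
move=> n0 le; rewrite /log2 mulrA ler_pdivlMr ?ln2_gt0 // !mulr_natl.
rewrite -!lnXn ?ltr0n // ler_ln ?posrE ?exprn_gt0 ?ltr0n //.
by rewrite -!natrX ler_nat.
Qed.

Lemma log2_lt (R : realType) (n : nat) : (0 < n)%N -> log2 (n%:R : R) < n%:R.
Proof.
move=> n0; rewrite /log2 ltr_pdivrMr ?ln2_gt0 // mulr_natl -lnXn ?ltr0n //.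
by rewrite ltr_ln ?posrE ?exprn_gt0 ?ltr0n // -natrX ltr_nat ltn_expl.
Qed.

(** Rounding [n] up to [2 ^ k] costs a factor of at most 2, and [k.+1 <= L + 2 <= 3 * L]; the spare
    powers of [t] absorb both constants. *)
Lemma r2_bound_power_ge2 (R : realType) (s t n : nat) : (1 < t)%N -> (1 < n)%N ->
  (r2 (complete s.+2) (path_power t n))%:R
    < t%:R ^+ (4 * s.+2) * n%:R * log2 (n%:R : R) ^+ s.
Proof.
move=> t1 n1; set L := log2 _.
have L1 : 1 <= L by have := log2_ge R 1 1 n; rewrite mul1r; apply; lia.
set k := up_log 2 n; have [lek ltk] : (n <= 2 ^ k /\ 2 ^ k.-1 < n)%N.
  by have /andP[] := up_log_bounds (leqnn 2) n1.
have k0 : (0 < k)%N by rewrite up_log_gt0 n1.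
have kL : k.+1%:R <= 3 * L.
  have := log2_ge R k.-1 1 n; rewrite mul1r expn1 => /(_ (ltnW n1) (ltnW ltk)) h.
  have -> : k.+1%:R = k.-1%:R + 2 :> R by rewrite -natrD; congr _%:R; lia.
  by rewrite -/L in h *; lra.
have k2n : (2 ^ k <= 2 * n)%N.
  by rewrite -(prednK k0) expnS leq_mul // ltnW.
have rle : (r2 (complete s.+2) (path_power t n) <= 2 * n * (t * k.+1) ^ s)%N.
  apply: leq_trans (leq_mul k2n (leqnn _)).
  apply: r2_leq_ramsey_bound; apply: ramsey_bound_power_leq lek _.
  by apply: ramsey_bound_pow2; apply: ltnW.
have Ls : 0 < L ^+ s by rewrite exprn_gt0 //; lra.
(* Of the exponent [8 + 4 * s], the part [4 * s] absorbs [(3 * t) ^ s] and the 8 absorbs the factor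
   2. *)
have ttl : (2 * (3 * t) ^ s < t ^ (4 * s.+2))%N.
  have t4 : (3 * t <= t ^ 4)%N.
    have : (2 * 2 <= t * t)%N by rewrite leq_mul.
    by rewrite !expnS expn0; nia.
  have t8 : (2 < t ^ 8)%N.
    by apply: (@leq_trans (2 ^ 8)) => //; rewrite leq_exp2r.
  have -> : (4 * s.+2 = 8 + 4 * s)%N by lia.
  rewrite expnD.
  apply: (@leq_ltn_trans (2 * t ^ (4 * s))).
    by rewrite leq_mul2l /= expnM; case: (s) => // s'; rewrite leq_exp2r.
  by rewrite ltn_mul2r expn_gt0 t8 andbT; lia.
apply: (@le_lt_trans _ _ ((2 * (3 * t) ^ s)%:R * n%:R * L ^+ s)); last first.
  rewrite -natrX ltr_pM2r // ltr_pM2r ?ltr0n ?ltr_nat //; lia.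
apply: (@le_trans _ _ (2 * n * (t * k.+1) ^ s)%:R); first by rewrite ler_nat.
rewrite !natrM !natrX !natrM -[leLHS]mulrA -[leRHS]mulrA.
have -> : 2 * (3 * t%:R) ^+ s * (n%:R * L ^+ s) = 2 * (n%:R * (t%:R * (3 * L)) ^+ s).
  by rewrite !exprMn; ring.
rewrite !ler_pM2l ?ltr0n //; last lia.
have t0 : 0 < t%:R :> R by rewrite ltr0n ltnW.
have le : t%:R * k.+1%:R <= t%:R * (3 * L) by rewrite ler_pM2l.
have ge0 : 0 <= t%:R * k.+1%:R :> R by rewrite mulr_ge0.
by apply: lerXn2r; rewrite ?nnegrE ?(le_trans ge0 le).
Qed.

Lemma r2_bound_path (R : realType) (s n : nat) :
  (2 < n)%N -> (0 < s)%N -> ~~ ((s == 1%N) && (n == 3%N)) ->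
  (r2 (complete s.+2) (path_power 1 n))%:R < n%:R * log2 (n%:R : R) ^+ s.
Proof.
move=> n2 s0 ex; set L := log2 _.
have rle : (r2 (complete s.+2) (path_power 1 n) <= (s.+1 * n.-1).+1)%N.
  have := ramsey_bound_path s.+1 n.-1; rewrite prednK; last lia.
  exact: r2_leq_ramsey_bound.
apply: (@le_lt_trans _ _ (s.+1 * n.-1).+1%:R); first by rewrite ler_nat.
case: (ltnP 3 n) => n3.
  have L2 : 2 <= L by have := log2_ge R 2 1 n; rewrite mul1r; apply; lia.
  (* The integer bound equals [n * s.+1 - s], and [s.+1 <= 2 ^ s]. *)
  apply: (@lt_le_trans _ _ (n%:R * 2 ^+ s)); last first.
    rewrite ler_pM2l; last by rewrite ltr0n; lia.
    by apply: lerXn2r; rewrite ?nnegrE //; lra.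
  rewrite -natrX -natrM ltr_nat.
  have : (s.+1 <= 2 ^ s)%N by rewrite ltn_expl.
  by nia.
have n3E : n = 3%N by lia.
have s2 : (1 < s)%N by move: ex; rewrite n3E andbT; lia.
(* [3 ^ 7 >= 2 ^ 11], hence [log2 3 >= 11 / 7], whose square exceeds [7 / 3]. *)
have L3 : 11 <= 7 * L by have := log2_ge R 11 7 n; apply; rewrite ?n3E.
rewrite n3E [3.-1]/=; elim: s s2 {s0 ex rle} => // s IHs; rewrite ltnS leq_eqVlt.
case/predU1P=> [<-|s1]; first by rewrite expr2 -[_.+1]/7%N; nra.
have := IHs s1; have sR : 1 <= s%:R :> R by rewrite ler1n ltnW.
have -> : (s.+1 * 2).+1%:R = 2 * s%:R + 3 :> R.
  by rewrite -natrM -natrD; congr _%:R; lia.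
have -> : (s.+2 * 2).+1%:R = 2 * s%:R + 5 :> R.
  by rewrite -natrM -natrD; congr _%:R; lia.
rewrite exprS; set X := L ^+ s => h.
(* The factor 11/7 outweighs the increment 2, since [11 * (2 * s + 3) > 7 * (2 * s + 5)] for
   [s >= 1]. *)
have : 0 <= (7 * L - 11) * X by apply: mulr_ge0; lra.
lra.
Qed.

Theorem theorem1p4 (R : realType) (s t n : nat)
    (hs : (0 < s)%N) (ht : (0 < t)%N) (hn : (0 < n)%N) (hts : (t <= s)%N) :
  (r2 (path_power t s) (path_power t n) <= r2 (complete s) (path_power t n))%N /\
  (~~ exceptional s t n ->
     (r2 (complete s) (path_power t n))%:R
       < t%:R ^+ (4 * s) * n%:R * log2 (n%:R : R) ^ (s%:Z - 2)).
Proof.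
split=> [|ex]; first exact: r2_path_power_complete.
case: s => [//|[|s]] in hs hts ex *.
  (* For single-vertex cliques the exponent is -1 and [t = 1], so the claim reads 1 < n / log n. *)
  have n1 : (1 < n)%N by move: ex; rewrite /exceptional; lia.
  have L1 : 1 <= log2 (n%:R : R).
    by have := log2_ge R 1 1 n; rewrite mul1r; apply.
  have -> : t = 1%N by lia.
  apply: (@le_lt_trans _ _ 1).
    by rewrite -[1]/1%:R ler_nat; apply/r2_leq_ramsey_bound/ramsey_bound_clique1.
  rewrite expr1n mul1r -[(_ - _ : int)]/(- 1 : int) exprN1.
  by rewrite ltr_pdivlMr ?mul1r ?log2_lt //; lra.
have -> : s.+2%:Z - 2 = s%:Z :> int by lia.
rewrite -exprnP; case: (ltnP 1 n) => n1; last first.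
  have n1E : n = 1%N by lia.
  have [s0 t1] : s = 0%N /\ (1 < t)%N by move: ex; rewrite /exceptional; lia.
  (* Here log 1 = 0 is raised to the power 0, which is 1, so only [1 < t ^ 8] remains. *)
  rewrite s0 n1E expr0 !mulr1 -natrX ltr_nat.
  apply: (@leq_ltn_trans 1); last by rewrite -{1}(exp1n 8) ltn_exp2r.
  exact/r2_leq_ramsey_bound/ramsey_bound_power1.
case: (ltnP 1 t) => t1; first exact: r2_bound_power_ge2.
have t1E : t = 1%N by lia.
(* Outside the exceptional triples, [t = 1] leaves [n >= 3] and cliques on at least three vertices,
   without the pair (3, 3). *)
move: ex; rewrite t1E expr1n mul1r /exceptional => ex.
by apply: r2_bound_path; lia.
Qed.
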